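(* Let $m$ be a positive integer, let $\nu,\mu\in\mathbb{C}$ with $|\mu|\leq 1$, and let $\Upsilon(z)=\nu z$ and $\Phi(z)=\mu z$ for $z\in\mathbb{C}$, such that $C_{\Upsilon,\Phi}$ is bounded on $H_E(\xi)$. Then $C_{\Upsilon,\Phi}$ is an $m$-isometry if and only if $$\sum_{k=1}^m(-1)^{m-k}\binom{m}{k}\,\xi_{n+k}^2\,|\nu|^{2k}\,|\mu|^{k(2n+k-1)}=(-1)^{m+1}\xi_n^2\quad\text{for all } n\geq 0.$$
   Context: Let $\xi=(\xi_n)_{n\ge 0}$ be a sequence of positive real numbers with $\lim_{n\to\infty}\xi_n^{1/n}=\infty$. $H_E(\xi)$ is the Hilbert space of entire functions $f(z)=\sum_{n=0}^\infty a_n z^n$ with $\|f\|^2=\sum_{n=0}^\infty |a_n|^2\xi_n^2<\infty$, with inner product $\langle f,g\rangle=\sum_{n=0}^\infty b_n\overline{c_n}\,\xi_n^2$ for $f=\sum b_nz^n$, $g=\sum c_nz^n$. For entire functions $\Upsilon,\Phi$, the weighted composition operator is $C_{\Upsilon,\Phi}f=\Upsilon\cdot(f\circ\Phi)$. For a positive integer $m$, a bounded operator $S$ is an $m$-isometry if $\sum_{k=0}^m(-1)^{m-k}\binom{m}{k}{S^*}^kS^k=0$. *)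

(* Defs.v *)
From Stdlib Require Import Reals ClassicalEpsilon.
From Coquelicot Require Import Coquelicot.

Open Scope R_scope.

(* [C] is the type of complex numbers; the binomial coefficient of the standard
   library, which has the same short name, is always written [Binomial.C]. *)

Definition entire (f : C -> C) : Prop :=
  forall z : C, ex_derive (K := C_AbsRing) (V := C_NormedModule) f z.

Definition has_expansion (a : nat -> C) (f : C -> C) : Prop :=
  forall z : C, is_pseries (K := C_AbsRing) (V := C_NormedModule) a z (f z).

(* Unspecified when [f] has no expansion converging on all of C; otherwise the
   sequence is unique, by the identity theorem for power series. *)
Definition coef (f : C -> C) : nat -> C :=
  epsilon (inhabits (fun _ : nat => RtoC 0)) (fun a => has_expansion a f).

Definition in_HE (xi : nat -> R) (f : C -> C) : Prop :=
  entire f /\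
  (exists a : nat -> C, has_expansion a f) /\
  ex_series (fun n => Cmod (coef f n) ^ 2 * xi n ^ 2).

Definition HE_norm (xi : nat -> R) (f : C -> C) : R :=
  sqrt (Series (fun n => Cmod (coef f n) ^ 2 * xi n ^ 2)).

(* [Series] is real-valued, so the complex series is summed by real and
   imaginary parts; both converge absolutely for [f] and [g] in the space. *)
Definition HE_inner (xi : nat -> R) (f g : C -> C) : C :=
  let t n := (coef f n * Cconj (coef g n) * RtoC (xi n ^ 2))%C in
  (Series (fun n => Re (t n)), Series (fun n => Im (t n))).

(* Operators are maps on all functions from C to C of which only the
   restriction to the space matters. *)
Definition bounded_operator (xi : nat -> R) (S : (C -> C) -> (C -> C)) : Prop :=
  (forall f, in_HE xi f -> in_HE xi (S f)) /\
  (forall (c : C) f g, in_HE xi f -> in_HE xi g ->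
     forall z : C,
       S (fun w => c * f w + g w)%C z = (c * S f z + S g z)%C) /\
  (exists M : R, forall f, in_HE xi f -> HE_norm xi (S f) <= M * HE_norm xi f).

(* For bounded [S], such a [T] exists and is unique on the space (Riesz). *)
Definition is_adjoint (xi : nat -> R) (S T : (C -> C) -> (C -> C)) : Prop :=
  bounded_operator xi T /\
  forall f g, in_HE xi f -> in_HE xi g -> HE_inner xi (S f) g = HE_inner xi f (T g).

Definition m_isometry (xi : nat -> R) (m : nat) (S : (C -> C) -> (C -> C)) : Prop :=
  bounded_operator xi S /\
  exists T, is_adjoint xi S T /\
    forall f, in_HE xi f -> forall z : C,
      sum_n (fun k =>
        (RtoC ((-1) ^ (m - k) * Binomial.C m k)
         * Nat.iter k T (Nat.iter k S f) z)%C) m = RtoC 0.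

Definition weighted_composition (Upsilon Phi : C -> C) (f : C -> C) : C -> C :=
  fun z => (Upsilon z * f (Phi z))%C.

(* Main.v *)
Require Import Defs.
From Stdlib Require Import Reals Lra Lia Classical ClassicalEpsilon.
From Coquelicot Require Import Coquelicot.
Open Scope R_scope.

(** On Taylor coefficients the operator S is the weighted forward shift
    a_n z^n |-> nu mu^n a_n z^(n+1), so its adjoint T is the weighted backward
    shift with weights conj(nu mu^n) xi_(n+1)^2 / xi_n^2. Hence T^k S^k is
    diagonal in the monomial basis, with entries
    |nu|^(2k) |mu|^(k(2n+k-1)) xi_(n+k)^2 / xi_n^2, and the alternating sum
    defining an m-isometry vanishes if and only if each of its diagonal entries
    does. *)

(** * Convergent series of complex numbers *)

Notation is_Cseries := (is_series (K := C_AbsRing) (V := C_NormedModule)).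

Lemma pow_n_Cpow (z : C) (n : nat) : pow_n (K := C_AbsRing) z n = (z ^ n)%C.
Proof. induction n as [|n IH]; [reflexivity|]. simpl. rewrite IH. reflexivity. Qed.

Lemma has_expansion_iff (a : nat -> C) (f : C -> C) :
  has_expansion a f <-> forall z, is_Cseries (fun n => z ^ n * a n)%C (f z).
Proof.
  split; intros H z; specialize (H z); unfold is_pseries in *.
  all: eapply is_series_ext; [|exact H]; intros n.
  - exact (f_equal (fun t => t * a n)%C (pow_n_Cpow z n)).
  - symmetry. exact (f_equal (fun t => t * a n)%C (pow_n_Cpow z n)).
Qed.

Lemma is_Cseries_unique (u : nat -> C) (l l' : C) :
  is_Cseries u l -> is_Cseries u l' -> l = l'.
Proof.
  intros H H'.
  exact (filterlim_locally_unique (V := C_NormedModule) (F := eventually) (sum_n u) l l' H H').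
Qed.

Lemma is_Cseries_plus (u v : nat -> C) (l l' : C) :
  is_Cseries u l -> is_Cseries v l' -> is_Cseries (fun n => u n + v n)%C (l + l')%C.
Proof. exact (is_series_plus (V := C_NormedModule) u v l l'). Qed.

Lemma is_Cseries_scal (c : C) (u : nat -> C) (l : C) :
  is_Cseries u l -> is_Cseries (fun n => c * u n)%C (c * l)%C.
Proof. exact (is_series_scal (V := C_NormedModule) c u l). Qed.

Lemma is_Cseries_decr_1 (u : nat -> C) (l : C) :
  is_Cseries (fun n => u (S n)) l -> is_Cseries u (l + u 0%nat)%C.
Proof.
  intros H. apply is_series_decr_1.
  match goal with |- is_series _ ?x => replace x with l; [exact H|] end.
  change (l = (l + u 0%nat + - u 0%nat)%C). ring.
Qed.

Lemma is_Cseries_incr_1 (u : nat -> C) (l : C) :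
  is_Cseries u (l + u 0%nat)%C -> is_Cseries (fun n => u (S n)) l.
Proof. exact (is_series_incr_1 (V := C_NormedModule) u l). Qed.

Lemma ex_Cseries_dominated (u : nat -> C) (b : nat -> R) :
  (forall n, Cmod (u n) <= b n) -> ex_series b -> exists l, is_Cseries u l.
Proof. exact (ex_series_le (V := C_CompleteNormedModule) u b). Qed.

(** The triangle inequality bounds every partial sum, and the bound passes to the limit because the
    norm is continuous. *)
Lemma Cmod_series_le (u : nat -> C) (b : nat -> R) (l : C) (B : R) :
  (forall n, Cmod (u n) <= b n) -> is_Cseries u l -> is_series b B -> Cmod l <= B.
Proof.
  intros Hle Hu Hb.
  assert (Hlim : is_lim_seq (fun n => norm (sum_n (G := C_NormedModule) u n)) (Cmod l)).
  { exact (filterlim_comp _ _ _ _ _ _ _ _ Hu (filterlim_norm (V := C_NormedModule) l)). }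
  refine (is_lim_seq_le _ (sum_n b) (Cmod l) B _ Hlim Hb).
  intros n. eapply Rle_trans; [apply (norm_sum_n_m (V := C_NormedModule))|].
  apply sum_n_m_le. exact Hle.
Qed.

(** * Coefficient sequences with infinite radius of convergence *)

Definition abs_entire (a : nat -> C) : Prop :=
  forall r, 0 <= r -> ex_series (fun n => Cmod (a n) * r ^ n).

(* Comparison of the radius [r] with [2 r + 1] gives a geometric majorant of ratio 1/2. *)
Lemma abs_entire_of_bounded (a : nat -> C) :
  (forall r, 0 < r -> exists M N, forall n, (N <= n)%nat -> Cmod (a n) * r ^ n <= M) ->
  abs_entire a.
Proof.
  intros H r Hr. destruct (H (2 * r + 1)) as (M & N & HM); [lra|].
  apply (ex_series_incr_n _ N).
  apply (ex_series_le (V := R_CompleteNormedModule) _ (fun n => M * (/ 2) ^ n)).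
  - intros n. change (Rabs (Cmod (a (N + n)%nat) * r ^ (N + n)) <= M * (/ 2) ^ n).
    rewrite Rabs_pos_eq; [|apply Rmult_le_pos; [apply Cmod_ge_0|now apply pow_le]].
    assert (HMn := HM (N + n)%nat ltac:(lia)).
    assert (Hq : r ^ (N + n) <= (2 * r + 1) ^ (N + n) * (/ 2) ^ (N + n)).
    { rewrite <- Rpow_mult_distr. apply pow_incr. lra. }
    assert (Hh : (/ 2) ^ (N + n) <= (/ 2) ^ n).
    { rewrite pow_add. rewrite <- (Rmult_1_l ((/2) ^ n)) at 2.
      apply Rmult_le_compat_r; [apply pow_le; lra|].
      rewrite <- (pow1 N). apply pow_incr. lra. }
    assert (Hp : 0 <= (/ 2) ^ (N + n)) by (apply pow_le; lra).
    assert (Ha := Cmod_ge_0 (a (N + n)%nat)).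
    assert (HM0 : 0 <= M).
    { eapply Rle_trans; [|exact HMn]. apply Rmult_le_pos; [easy|apply pow_le; lra]. }
    eapply Rle_trans; [apply Rmult_le_compat_l; [easy|exact Hq]|].
    rewrite <- Rmult_assoc.
    eapply Rle_trans; [apply Rmult_le_compat_r; [easy|exact HMn]|].
    now apply Rmult_le_compat_l.
  - apply (ex_series_scal_l (V := R_NormedModule) M (fun n => (/ 2) ^ n)), ex_series_geom. rewrite Rabs_pos_eq; lra.
Qed.

(** Convergence at the point [r] bounds the partial sums by some [M]; each later term is a
    difference of two consecutive partial sums, hence at most [2 * M]. *)
Lemma has_expansion_abs_entire (a : nat -> C) (f : C -> C) :
  has_expansion a f -> abs_entire a.
Proof.
  intros H. apply abs_entire_of_bounded. intros r Hr.
  assert (Hs := proj1 (has_expansion_iff a f) H (RtoC r)).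
  set (u := fun n : nat => (RtoC r ^ n * a n)%C) in Hs.
  destruct (filterlim_bounded (V := C_NormedModule) (sum_n u)) as [M HM].
  { now exists (f (RtoC r)). }
  exists (2 * M), 0%nat. intros n _.
  assert (Hu : Cmod (a n) * r ^ n = Cmod (u n)).
  { unfold u. rewrite Cmod_mult, Cmod_pow, Cmod_R, Rabs_pos_eq; lra. }
  rewrite Hu. change (forall n, Cmod (sum_n (G := C_NormedModule) u n) <= M) in HM.
  destruct n as [|n].
  - assert (H0 := HM 0%nat). rewrite sum_O in H0. assert (Hp := Cmod_ge_0 (u 0%nat)). lra.
  - assert (H0 := HM n). assert (H1 := HM (S n)). rewrite sum_Sn in H1.
    replace (u (S n)) with ((sum_n (G := C_NormedModule) u n + u (S n)) - sum_n (G := C_NormedModule) u n)%C by ring.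
    eapply Rle_trans; [apply Cmod_triangle|]. rewrite Cmod_opp.
    change (Cmod (sum_n (G := C_NormedModule) u n + u (S n))%C <= M) in H1. lra.
Qed.

Lemma abs_entire_expansion (a : nat -> C) :
  abs_entire a -> exists f, has_expansion a f.
Proof.
  intros Ha.
  assert (H : forall z : C, exists l, is_Cseries (fun n => z ^ n * a n)%C l).
  { intros z. apply (ex_Cseries_dominated _ _ (fun n => Req_le _ _ eq_refl)).
    eapply ex_series_ext; [|exact (Ha (Cmod z) (Cmod_ge_0 z))].
    intros n. simpl. rewrite Cmod_mult, Cmod_pow. apply Rmult_comm. }
  exists (fun z => proj1_sig (constructive_indefinite_description _ (H z))).
  apply has_expansion_iff. intros z. apply proj2_sig.
Qed.

(** * Differentiability of sums of power series *)

(** Induction on [n]: the remainder at [S n] is [z + h] times the remainder at [n], plus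
    [n z^(n-1) h^2]. Since [n <= 2^n] and [1 <= r], each of the two pieces is at most
    [2^n r^(n+1) |h|^2]. *)
Lemma pow_taylor_bound (z h : C) (r : R) (n : nat) :
  1 <= r -> Cmod z <= r -> Cmod (z + h) <= r ->
  Cmod ((z + h) ^ n - z ^ n - INR n * z ^ (pred n) * h)%C <= (2 * r) ^ n * Cmod h ^ 2.
Proof.
  intros Hr Hz Hzh. induction n as [|n IH].
  - simpl. replace (1 - 1 - 0 * 1 * h)%C with (RtoC 0) by ring.
    rewrite Cmod_0. assert (Hh := pow2_ge_0 (Cmod h)). simpl in Hh. lra.
  - replace ((z + h) ^ S n - z ^ S n - INR (S n) * z ^ pred (S n) * h)%C
      with ((z + h) * ((z + h) ^ n - z ^ n - INR n * z ^ (pred n) * h)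
            + INR n * z ^ (pred n) * (h * h))%C.
    2:{ rewrite S_INR, RtoC_plus. destruct n as [|n].
        - simpl. ring.
        - simpl pred. rewrite !Cpow_S. ring. }
    eapply Rle_trans; [apply Cmod_triangle|].
    rewrite !Cmod_mult, Cmod_R, Cmod_pow, (Rabs_pos_eq (INR n)) by apply pos_INR.
    assert (Hh := pow2_ge_0 (Cmod h)).
    assert (Hn : INR n <= 2 ^ n).
    { rewrite <- (pow_INR 2). apply le_INR, Nat.lt_le_incl, Nat.pow_gt_lin_r. lia. }
    assert (Hzn : Cmod z ^ pred n <= r ^ S n).
    { apply Rle_trans with (r ^ pred n); [apply pow_incr; split; [apply Cmod_ge_0|easy]|].
      apply Rle_pow; [easy|lia]. }
    assert (H1 : Cmod (z + h) * Cmod ((z + h) ^ n - z ^ n - INR n * z ^ pred n * h)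
                 <= r * ((2 * r) ^ n * Cmod h ^ 2)).
    { apply Rmult_le_compat; auto using Cmod_ge_0. }
    assert (H2 : INR n * Cmod z ^ pred n <= 2 ^ n * r ^ S n).
    { apply Rmult_le_compat; auto using pos_INR, pow_le, Cmod_ge_0. }
    assert (H3 : INR n * Cmod z ^ pred n * (Cmod h * Cmod h) <= 2 ^ n * r ^ S n * Cmod h ^ 2).
    { replace (Cmod h * Cmod h) with (Cmod h ^ 2) by ring. now apply Rmult_le_compat_r. }
    rewrite Rpow_mult_distr in *. simpl in *. lra.
Qed.

(* [pow_taylor_bound], summed against [a], bounds the first-order remainder by
   a multiple of [Cmod h ^ 2]. *)
Lemma has_expansion_entire (a : nat -> C) (f : C -> C) :
  has_expansion a f -> entire f.
Proof.
  intros H z.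
  assert (Ha := has_expansion_abs_entire a f H).
  rewrite has_expansion_iff in H.
  set (r := Cmod z + 1). assert (Hz0 := Cmod_ge_0 z).
  destruct (Ha (2 * r)) as [B HB]; [unfold r; lra|].
  assert (HB0 : 0 <= B).
  { apply (is_lim_seq_le (fun _ => 0) (sum_n (fun n => Cmod (a n) * (2 * r) ^ n)) 0 B);
      [|apply is_lim_seq_const|exact HB].
    intros n. rewrite <- (Rmult_0_r (INR (S n))), <- (sum_n_const n 0).
    apply sum_n_m_le. intros k. apply Rmult_le_pos; [apply Cmod_ge_0|apply pow_le; unfold r; lra]. }
  (* The derivative [l] is the sum of the termwise derived series, dominated by means of
     [n <= 2^n]. *)
  destruct (ex_Cseries_dominated (fun n => (INR n * z ^ pred n) * a n)%C
              (fun n => Cmod (a n) * (2 * r) ^ n)) as [l Hl].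
  { intros n. rewrite !Cmod_mult, Cmod_R, Cmod_pow, (Rabs_pos_eq (INR n)) by apply pos_INR.
    rewrite Rmult_comm. apply Rmult_le_compat_l; [apply Cmod_ge_0|].
    rewrite Rpow_mult_distr. apply Rmult_le_compat; auto using pos_INR, pow_le.
    - rewrite <- (pow_INR 2). apply le_INR, Nat.lt_le_incl, Nat.pow_gt_lin_r. lia.
    - apply Rle_trans with (r ^ pred n); [apply pow_incr; unfold r; lra|].
      apply Rle_pow; [unfold r; lra|lia]. }
  { now exists B. }
  exists l. split.
  { exact (is_linear_scal_l (V := C_NormedModule) (l : C_NormedModule)). }
  intros x Hx eps.
  apply (is_filter_lim_locally_unique (V := AbsRing_NormedModule C_AbsRing)) in Hx. subst x.
  (* The bound 1 keeps [z + h] in the disc of radius [r = |z| + 1], and the other bound gives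
     [|h| * B <= eps]. The denominator is [B + 1] because [B] may be 0. *)
  assert (Hd : 0 < Rmin 1 (eps / (B + 1))).
  { apply Rmin_glb_lt; [lra|]. apply Rdiv_lt_0_compat; [apply cond_pos|lra]. }
  exists (mkposreal _ Hd). intros y Hy.
  change (Cmod (y - z)%C < Rmin 1 (eps / (B + 1))) in Hy.
  change (Cmod (f y - f z - (y - z) * l)%C <= eps * Cmod (y - z)%C).
  set (h := (y - z)%C) in *.
  assert (Hh1 : Cmod h < 1) by (eapply Rlt_le_trans; [exact Hy|apply Rmin_l]).
  assert (Hh2 : Cmod h * (B + 1) <= eps).
  { apply Rmult_le_reg_r with (/ (B + 1)); [apply Rinv_0_lt_compat; lra|].
    rewrite Rmult_assoc, Rinv_r, Rmult_1_r by lra.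
    apply Rlt_le. eapply Rlt_le_trans; [exact Hy|apply Rmin_r]. }
  assert (Ey : y = (z + h)%C).
  { assert (Hsub : forall u v : C, u = (v + (u - v))%C) by (intros; ring). apply Hsub. }
  assert (Hbound : Cmod (f y - f z - h * l)%C <= Cmod h ^ 2 * B).
  { apply (Cmod_series_le
      (fun n => a n * ((z + h) ^ n - z ^ n - INR n * z ^ pred n * h))%C
      (fun n => Cmod h ^ 2 * (Cmod (a n) * (2 * r) ^ n))).
    - intros n. rewrite Cmod_mult, (Rmult_comm (Cmod h ^ 2)), Rmult_assoc.
      apply Rmult_le_compat_l; [apply Cmod_ge_0|].
      apply pow_taylor_bound; unfold r; try lra.
      eapply Rle_trans; [apply Cmod_triangle|lra].
    - apply (is_series_ext (V := C_NormedModule)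
        (fun n => (y ^ n * a n + (-1) * (z ^ n * a n)) + - h * ((INR n * z ^ pred n) * a n))%C).
      { intros n. rewrite Ey.
        change (?x = ?y) with ((x : C) = y). ring. }
      replace (f y - f z - h * l)%C with ((f y + (-1) * f z) + - h * l)%C by ring.
      apply is_Cseries_plus; [apply is_Cseries_plus|]; [apply H|apply is_Cseries_scal, H|].
      now apply is_Cseries_scal.
    - exact (is_series_scal (V := R_NormedModule) (Cmod h ^ 2) _ B HB). }
  eapply Rle_trans; [exact Hbound|].
  assert (Hh0 := Cmod_ge_0 h). nra.
Qed.

(** * The identity theorem and uniqueness of Taylor coefficients *)

(** Peeling off zero terms reduces to [n = 0], where the remaining tail is identically zero. This
    evaluates all norms and inner products against monomials. *)
Lemma is_series_single {K : AbsRing} {V : NormedModule K} (u : nat -> V) (n : nat) :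
  (forall k, k <> n -> u k = zero) -> is_series u (u n).
Proof.
  revert u. induction n as [|n IH]; intros u Hu; apply is_series_decr_1.
  - rewrite (plus_opp_r (G := V)). apply (filterlim_ext (fun _ => zero)); [|apply filterlim_const].
    induction x as [|p IHp].
    + rewrite sum_O. symmetry. now apply Hu.
    + now rewrite sum_Sn, <- IHp, plus_zero_l, Hu.
  - rewrite (Hu 0%nat) by easy.
    match goal with |- is_series _ ?l => replace l with (u (S n)) end.
    2:{ symmetry. exact (minus_zero_r (G := V) (u (S n))). }
    apply (IH (fun k => u (S k))). intros k Hk. apply Hu. lia.
Qed.

Lemma has_expansion_at_0 (a : nat -> C) (f : C -> C) :
  has_expansion a f -> f 0 = a 0%nat.
Proof.
  rewrite has_expansion_iff. intros H. apply (is_Cseries_unique _ _ _ (H 0)).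
  replace (a 0%nat) with (0 ^ 0 * a 0%nat)%C by (simpl; ring).
  apply (is_series_single (V := C_NormedModule) (fun n => 0 ^ n * a n)%C 0).
  intros [|k] Hk; [easy|].
  change ((0 * 0 ^ k * a (S k))%C = RtoC 0). ring.
Qed.

(** Removes one coefficient for the induction in the identity theorem. Off the origin [g] is
    [(f z - a 0) / z]; at the origin division is impossible, but there the shifted series reduces to
    its constant term. *)
Lemma has_expansion_tail (a : nat -> C) (f : C -> C) :
  has_expansion a f ->
  exists g, has_expansion (fun n => a (S n)) g /\ forall z, f z = (a 0%nat + z * g z)%C.
Proof.
  intros Hf. assert (H := proj1 (has_expansion_iff a f) Hf).
  assert (Hex : forall z : C, exists l, is_Cseries (fun n => z ^ n * a (S n))%C l).
  { intros z. destruct (Ceq_dec z 0) as [->|Hz].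
    - exists (0 ^ 0 * a 1%nat)%C.
      apply (is_series_single (V := C_NormedModule) (fun n => 0 ^ n * a (S n))%C 0).
      intros [|k] Hk; [easy|].
      change ((0 * 0 ^ k * a (S (S k)))%C = RtoC 0). ring.
    - exists (/ z * (f z - a 0%nat))%C.
      apply (is_series_ext (V := C_NormedModule) (fun n => / z * (z ^ S n * a (S n)))%C).
      { intros n. rewrite Cpow_S. change (?x = ?y) with ((x : C) = y). now field. }
      apply is_Cseries_scal, (is_Cseries_incr_1 (fun n => z ^ n * a n)%C).
      replace (f z - a 0%nat + z ^ 0 * a 0%nat)%C with (f z) by (simpl; ring).
      apply H. }
  exists (fun z => proj1_sig (constructive_indefinite_description _ (Hex z))).
  assert (Hg : forall z, is_Cseries (fun n => z ^ n * a (S n))%C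
           (proj1_sig (constructive_indefinite_description _ (Hex z)))).
  { intros z. apply proj2_sig. }
  split; [now apply has_expansion_iff|].
  intros z. apply (is_Cseries_unique _ _ _ (H z)).
  match goal with |- is_series _ (_ + ?x)%C =>
    replace (a 0%nat + x)%C with (x + z ^ 0 * a 0%nat)%C by (simpl; ring) end.
  apply (is_Cseries_decr_1 (fun n => z ^ n * a n)%C).
  apply (is_series_ext (V := C_NormedModule) (fun n => z * (z ^ n * a (S n)))%C).
  { intros n. rewrite Cpow_S. change (?x = ?y) with ((x : C) = y). ring. }
  now apply is_Cseries_scal.
Qed.

(** Induction on [n]: the constant coefficient is [f 0], and the quotient of [f] by [z] is again
    identically zero, with the coefficients shifted by one. *)
Lemma expansion_zero_coef (a : nat -> C) (f : C -> C) :
  has_expansion a f -> (forall z, f z = 0) -> forall n, a n = 0.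
Proof.
  intros Hf H0 n. revert a f Hf H0. induction n as [|n IH]; intros a f Hf H0.
  - now rewrite <- (has_expansion_at_0 a f Hf).
  - destruct (has_expansion_tail a f Hf) as (g & Hg & Hfg).
    apply (IH (fun k => a (S k)) g Hg).
    (* [z * g z = 0] gives [g = 0] off the origin, and at the origin by continuity. *)
    assert (Hnz : forall z : C, z <> 0 -> g z = 0).
    { intros z Hz. assert (E := Hfg z). rewrite H0 in E.
      assert (Ha := has_expansion_at_0 a f Hf). rewrite H0 in Ha. rewrite <- Ha in E.
      replace (g z) with (/ z * (0 + z * g z))%C by (field; exact Hz).
      rewrite <- E. ring. }
    intros z. destruct (Ceq_dec z 0) as [->|Hz]; [|now apply Hnz].
    apply NNPP. intros Hg0. apply Cmod_gt_0 in Hg0.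
    assert (Hc := ex_derive_continuous _ _ (has_expansion_entire _ _ Hg 0)).
    (* Balls around values of [g] are squares, so closeness is componentwise. Comparing [g 0] with
       the value 0 at the nonzero point [d / 2] puts both components of [g 0] below [|g 0| / 2],
       whence [|g 0| < sqrt 2 * |g 0| / 2 < |g 0|], a contradiction. *)
    assert (Hg2 : 0 < Cmod (g 0) / 2) by lra.
    destruct (proj1 (filterlim_locally g (g 0)) Hc (mkposreal _ Hg2)) as [d Hd].
    assert (Hdpos := cond_pos d).
    assert (Hd2 : RtoC (d / 2) <> 0) by (intros E; apply RtoC_inj in E; lra).
    specialize (Hd (RtoC (d / 2))). rewrite (Hnz _ Hd2) in Hd.
    destruct Hd as [HRe HIm].
    { change (Cmod (RtoC (d / 2) - 0)%C < d).
      unfold Cminus. rewrite <- RtoC_opp, <- RtoC_plus, Cmod_R, Rabs_pos_eq; lra. }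
    change (Rabs (0 - fst (g 0)) < Cmod (g 0) / 2) in HRe.
    change (Rabs (0 - snd (g 0)) < Cmod (g 0) / 2) in HIm.
    rewrite Rminus_0_l, Rabs_Ropp in HRe, HIm.
    assert (Hmax := Cmod_2Rmax (g 0)).
    assert (Hlt := Rmax_lub_lt _ _ _ HRe HIm).
    assert (Hs2 : sqrt 2 < 2) by (rewrite <- (sqrt_pow2 2) at 2 by lra; apply sqrt_lt_1; lra).
    assert (Hs0 := sqrt_pos 2). nra.
Qed.

Lemma has_expansion_comb (c : C) (a b : nat -> C) (f g : C -> C) :
  has_expansion a f -> has_expansion b g ->
  has_expansion (fun n => c * a n + b n)%C (fun z => c * f z + g z)%C.
Proof.
  rewrite !has_expansion_iff. intros Hf Hg z.
  apply (is_series_ext (V := C_NormedModule) (fun n => c * (z ^ n * a n) + z ^ n * b n)%C).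
  { intros n. change (?x = ?y) with ((x : C) = y). ring. }
  apply is_Cseries_plus; [apply is_Cseries_scal|]; auto.
Qed.

Lemma has_expansion_ext (a b : nat -> C) (f : C -> C) :
  (forall n, a n = b n) -> has_expansion a f -> has_expansion b f.
Proof.
  rewrite !has_expansion_iff. intros Hab Hf z.
  eapply is_series_ext; [|apply Hf]. intros n. simpl. now rewrite Hab.
Qed.

Lemma has_expansion_unique (a : nat -> C) (f g : C -> C) :
  has_expansion a f -> has_expansion a g -> forall z, f z = g z.
Proof.
  rewrite !has_expansion_iff. intros Hf Hg z. eapply is_Cseries_unique; [apply Hf|apply Hg].
Qed.

Lemma coef_spec (f : C -> C) : (exists a, has_expansion a f) -> has_expansion (coef f) f.
Proof. exact (epsilon_spec (inhabits (fun _ : nat => RtoC 0)) (fun a => has_expansion a f)). Qed.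

(** The difference of two expansions of [f] expands the zero function, so the identity theorem
    determines the sequence that [epsilon] selects. *)
Lemma coef_eq (a : nat -> C) (f : C -> C) :
  has_expansion a f -> forall n, coef f n = a n.
Proof.
  intros H n.
  assert (Hc : has_expansion (coef f) f) by (apply coef_spec; now exists a).
  assert (E : (-1 * a n + coef f n)%C = 0).
  { apply (expansion_zero_coef (fun n => -1 * a n + coef f n)%C (fun z => -1 * f z + f z)%C).
    - now apply has_expansion_comb.
    - intros z. ring. }
  replace (coef f n) with (a n + (-1 * a n + coef f n))%C by ring.
  rewrite E. ring.
Qed.

(** * Membership in the space, and monomials as test functions *)

Definition square_summable (xi : nat -> R) (a : nat -> C) : Prop :=
  ex_series (fun n => Cmod (a n) ^ 2 * xi n ^ 2).

(** The growth of [xi] enters here. Eventually [|a n| * xi n < 1], since the terms of a convergent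
    series tend to 0, and eventually [r^n <= xi n], since the n-th roots exceed [r]; hence
    [|a n| * r^n] is eventually at most 1. *)
Lemma square_summable_abs_entire (xi : nat -> R) (a : nat -> C) :
  (forall n, 0 < xi n) ->
  is_lim_seq (fun n => Rpower (xi n) (/ INR n)) p_infty ->
  square_summable xi a -> abs_entire a.
Proof.
  intros xi_pos xi_root Ha. apply abs_entire_of_bounded. intros r Hr.
  assert (H0 := ex_series_lim_0 _ Ha).
  destruct (proj2 (is_lim_seq_spec _ _) H0 (mkposreal 1 Rlt_0_1)) as [N1 HN1].
  destruct (proj2 (is_lim_seq_spec _ _) xi_root r) as [N2 HN2].
  (* The successor forces [n >= 1], so that [/ INR n] is a genuine inverse. *)
  exists 1, (S (N1 + N2)). intros n Hn.
  specialize (HN1 n ltac:(lia)). specialize (HN2 n ltac:(lia)). simpl pos in HN1.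
  assert (Hn0 : 0 < INR n) by (apply lt_0_INR; lia).
  assert (Hxi : r ^ n <= xi n).
  { rewrite <- (Rpower_1 (xi n)), <- (Rinv_l (INR n)), <- Rpower_mult, Rpower_pow;
      [|unfold Rpower; apply exp_pos|lra|apply xi_pos].
    apply pow_incr. lra. }
  assert (Hc := Cmod_ge_0 (a n)).
  eapply Rle_trans; [apply Rmult_le_compat_l; [easy|exact Hxi]|].
  rewrite Rminus_0_r, Rabs_pos_eq in HN1
    by (apply Rmult_le_pos; apply pow2_ge_0).
  rewrite <- Rpow_mult_distr in HN1. nra.
Qed.

Lemma in_HE_intro (xi : nat -> R) (a : nat -> C) (f : C -> C) :
  has_expansion a f -> square_summable xi a -> in_HE xi f.
Proof.
  intros Hf Ha. split; [exact (has_expansion_entire a f Hf)|]. split; [now exists a|].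
  eapply ex_series_ext; [|exact Ha]. intros n. simpl. now rewrite (coef_eq a f Hf).
Qed.

Lemma in_HE_expansion (xi : nat -> R) (f : C -> C) :
  in_HE xi f -> has_expansion (coef f) f.
Proof. intros (_ & H & _). now apply coef_spec. Qed.

Lemma monomial_expansion (n : nat) :
  has_expansion (fun k => if Nat.eq_dec k n then RtoC 1 else RtoC 0) (fun z => z ^ n)%C.
Proof.
  apply has_expansion_iff. intros z.
  set (u := fun k => (z ^ k * (if Nat.eq_dec k n then RtoC 1 else RtoC 0))%C).
  replace (z ^ n)%C with (u n).
  - apply (is_series_single (V := C_NormedModule) u n). intros k Hk. unfold u.
    destruct (Nat.eq_dec k n); [easy|]. change ((z ^ k * 0)%C = RtoC 0). ring.
  - unfold u. destruct (Nat.eq_dec n n); [|easy]. ring.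
Qed.

Lemma coef_monomial (n k : nat) :
  coef (fun z => z ^ n)%C k = if Nat.eq_dec k n then RtoC 1 else RtoC 0.
Proof. exact (coef_eq _ _ (monomial_expansion n) k). Qed.

Lemma in_HE_monomial (xi : nat -> R) (n : nat) : in_HE xi (fun z => z ^ n)%C.
Proof.
  apply (in_HE_intro _ _ _ (monomial_expansion n)). eexists.
  apply (is_series_single (V := R_NormedModule) _ n). intros k Hk.
  destruct (Nat.eq_dec k n); [easy|]. rewrite Cmod_0.
  change (0 ^ 2 * xi k ^ 2 = 0). ring.
Qed.

Lemma HE_norm_single (xi : nat -> R) (f : C -> C) (n : nat) :
  0 <= xi n -> (forall k, k <> n -> coef f k = 0) ->
  HE_norm xi f = Cmod (coef f n) * xi n.
Proof.
  intros Hxi Hf. unfold HE_norm.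
  rewrite (is_series_unique _ (Cmod (coef f n) ^ 2 * xi n ^ 2)).
  - rewrite <- Rpow_mult_distr. apply sqrt_pow2, Rmult_le_pos; [apply Cmod_ge_0|easy].
  - apply (is_series_single (V := R_NormedModule) (fun n => Cmod (coef f n) ^ 2 * xi n ^ 2) n).
    intros k Hk. rewrite (Hf k Hk), Cmod_0. change (0 ^ 2 * xi k ^ 2 = 0). ring.
Qed.

Lemma HE_inner_single (xi : nat -> R) (f g : C -> C) (n : nat) :
  (forall k, k <> n -> coef f k = 0) ->
  HE_inner xi f g = (coef f n * Cconj (coef g n) * RtoC (xi n ^ 2))%C.
Proof.
  intros Hf. unfold HE_inner.
  set (t := fun k => (coef f k * Cconj (coef g k) * RtoC (xi k ^ 2))%C).
  assert (Ht : forall k, k <> n -> t k = 0).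
  { intros k Hk. unfold t. rewrite (Hf k Hk). ring. }
  rewrite (is_series_unique _ (Re (t n))), (is_series_unique _ (Im (t n))).
  - symmetry. apply surjective_pairing.
  - apply (is_series_single (V := R_NormedModule) (fun k => Im (t k)) n).
    intros k Hk. now rewrite (Ht k Hk).
  - apply (is_series_single (V := R_NormedModule) (fun k => Re (t k)) n).
    intros k Hk. now rewrite (Ht k Hk).
Qed.

(** * The forward and backward weighted shifts on coefficients *)

Definition fwd (nu mu : C) (a : nat -> C) (n : nat) : C :=
  match n with
  | O => 0
  | S p => (nu * mu ^ p * a p)%C
  end.

Definition bwd (xi : nat -> R) (nu mu : C) (b : nat -> C) (n : nat) : C :=
  (Cconj (nu * mu ^ n) * RtoC (xi (S n) ^ 2 / xi n ^ 2) * b (S n))%C.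

Definition shift_op (nu mu : C) : (C -> C) -> (C -> C) :=
  weighted_composition (fun z : C => (nu * z)%C) (fun z : C => (mu * z)%C).

Lemma shift_op_expansion (nu mu : C) (a : nat -> C) (f : C -> C) :
  has_expansion a f -> has_expansion (fwd nu mu a) (shift_op nu mu f).
Proof.
  rewrite !has_expansion_iff. intros Hf z. unfold shift_op, weighted_composition.
  replace (nu * z * f (mu * z))%C
    with (nu * z * f (mu * z) + z ^ 0 * fwd nu mu a 0)%C by (simpl; ring).
  apply (is_Cseries_decr_1 (fun n => z ^ n * fwd nu mu a n)%C).
  apply (is_series_ext (V := C_NormedModule) (fun n => nu * z * ((mu * z) ^ n * a n))%C).
  { intros n. simpl fwd. rewrite Cpow_S, Cpow_mult_l.
    change (?x = ?y) with ((x : C) = y). ring. }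
  apply is_Cseries_scal, Hf.
Qed.

Lemma shift_op_coef (nu mu : C) (f : C -> C) (n : nat) :
  has_expansion (coef f) f -> coef (shift_op nu mu f) n = fwd nu mu (coef f) n.
Proof. intros Hf. now apply coef_eq, shift_op_expansion. Qed.

Lemma shift_op_monomial_coef (nu mu : C) (n k : nat) :
  coef (shift_op nu mu (fun z => z ^ n)%C) k
  = if Nat.eq_dec k (S n) then (nu * mu ^ n)%C else 0.
Proof.
  rewrite (coef_eq _ _ (shift_op_expansion _ _ _ _ (monomial_expansion n))).
  destruct k as [|k]; simpl fwd; [now destruct (Nat.eq_dec 0 (S n))|].
  destruct (Nat.eq_dec (S k) (S n)) as [E|E], (Nat.eq_dec k n) as [Hk|Hk]; try lia.
  - subst k. ring.
  - ring.
Qed.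

(** Solves for [b] by conjugating, which fixes the real factors. The equation is the one produced by
    testing the adjoint relation on a monomial. *)
Lemma Cconj_pos_div (c b b' : C) (x y : R) :
  y <> 0 -> (c * Cconj b' * RtoC x)%C = (Cconj b * RtoC y)%C ->
  b = (Cconj c * RtoC (x / y) * b')%C.
Proof.
  intros Hy E.
  assert (E' := f_equal Cconj E).
  rewrite !Cmult_conj, !Cconj_conj in E'.
  assert (HR : forall r : R, Cconj (RtoC r) = RtoC r).
  { intros r. unfold Cconj, RtoC. simpl. now rewrite Ropp_0. }
  rewrite !HR in E'.
  rewrite RtoC_div by easy.
  replace (Cconj c * (x / y) * b')%C with (Cconj c * b' * x / y)%C
    by (field; intros F; apply Hy, RtoC_inj, F).
  rewrite E'. field. intros F. apply Hy, RtoC_inj, F.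
Qed.

(** Pairing with [z^n] isolates coefficient [n] of [T g], while [S z^n = nu mu^n z^(n+1)] isolates
    coefficient [n + 1] of [g]. So every adjoint acts on the space as the backward shift. *)
Lemma adjoint_coef (xi : nat -> R) (nu mu : C) (T : (C -> C) -> (C -> C)) (g : C -> C) (n : nat) :
  (forall n, 0 < xi n) -> is_adjoint xi (shift_op nu mu) T -> in_HE xi g ->
  coef (T g) n = bwd xi nu mu (coef g) n.
Proof.
  intros xi_pos [_ Hadj] Hg.
  assert (E := Hadj _ g (in_HE_monomial xi n) Hg).
  rewrite (HE_inner_single _ _ _ (S n)), (HE_inner_single _ (fun z => z ^ n)%C _ n) in E.
  - rewrite shift_op_monomial_coef, coef_monomial in E.
    destruct (Nat.eq_dec (S n) (S n)), (Nat.eq_dec n n); try easy.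
    rewrite Cmult_1_l in E. apply Cconj_pos_div; [|exact E].
    apply pow_nonzero. specialize (xi_pos n). lra.
  - intros k Hk. rewrite coef_monomial. now destruct (Nat.eq_dec k n).
  - intros k Hk. rewrite shift_op_monomial_coef. now destruct (Nat.eq_dec k (S n)).
Qed.

(** Testing the operator bound on [z^n] gives [|nu mu^n| xi_(n+1) <= M xi_n], which is exactly what
    bounds the backward shift term by term. *)
Lemma bwd_norm_bound (xi : nat -> R) (nu mu : C) :
  (forall n, 0 < xi n) -> bounded_operator xi (shift_op nu mu) ->
  exists M, 0 <= M /\ forall b n,
    Cmod (bwd xi nu mu b n) ^ 2 * xi n ^ 2 <= M ^ 2 * (Cmod (b (S n)) ^ 2 * xi (S n) ^ 2).
Proof.
  intros xi_pos (_ & _ & M & HM).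
  assert (Hw : forall n, Cmod (nu * mu ^ n) * xi (S n) <= M * xi n).
  { intros n. assert (Hn := HM _ (in_HE_monomial xi n)).
    rewrite (HE_norm_single _ _ (S n)), (HE_norm_single _ _ n) in Hn.
    - rewrite shift_op_monomial_coef, coef_monomial in Hn.
      destruct (Nat.eq_dec (S n) (S n)), (Nat.eq_dec n n); try easy.
      now rewrite Cmod_1, Rmult_1_l in Hn.
    - now apply Rlt_le.
    - intros k Hk. rewrite coef_monomial. now destruct (Nat.eq_dec k n).
    - now apply Rlt_le.
    - intros k Hk. rewrite shift_op_monomial_coef. now destruct (Nat.eq_dec k (S n)). }
  exists M. split.
  (* The weight inequality at [n = 0] forces [M] to be nonnegative. *)
  - apply Rmult_le_reg_r with (xi 0%nat); [apply xi_pos|]. rewrite Rmult_0_l.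
    eapply Rle_trans; [|apply Hw].
    apply Rmult_le_pos; [apply Cmod_ge_0|now apply Rlt_le].
  - intros b n. assert (Hn := xi_pos n). assert (HSn := xi_pos (S n)).
    unfold bwd. rewrite !Cmod_mult, Cmod_conj, Cmod_R.
    rewrite Rabs_pos_eq
      by (apply Rlt_le, Rdiv_lt_0_compat; now apply pow_lt).
    rewrite <- !Rpow_mult_distr. apply pow_incr.
    assert (Hb := Cmod_ge_0 (b (S n))). assert (Hc := Cmod_ge_0 (nu * mu ^ n)).
    split.
    + repeat apply Rmult_le_pos; try easy; try lra.
      apply Rlt_le, Rinv_0_lt_compat. now apply pow_lt.
    + replace (Cmod (nu * mu ^ n) * (xi (S n) ^ 2 / xi n ^ 2) * Cmod (b (S n)) * xi n)
        with ((Cmod (nu * mu ^ n) * xi (S n)) * / xi n * (Cmod (b (S n)) * xi (S n)))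
        by (field; lra).
      apply Rmult_le_compat_r; [apply Rmult_le_pos; lra|].
      apply Rmult_le_reg_r with (xi n); [easy|].
      rewrite Rmult_assoc, Rinv_l, Rmult_1_r by lra. apply Hw.
Qed.

(* The backward-shifted coefficients need not define an entire function when [g]
   is outside the space; [epsilon] is then arbitrary. *)
Definition shift_adj (xi : nat -> R) (nu mu : C) (g : C -> C) : C -> C :=
  epsilon (inhabits g) (fun h => has_expansion (bwd xi nu mu (coef g)) h).

Lemma shift_adj_spec (xi : nat -> R) (nu mu : C) (g : C -> C) :
  (exists h, has_expansion (bwd xi nu mu (coef g)) h) ->
  has_expansion (bwd xi nu mu (coef g)) (shift_adj xi nu mu g).
Proof.
  exact (epsilon_spec (inhabits g) (fun h => has_expansion (bwd xi nu mu (coef g)) h)).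
Qed.

Lemma ex_series_dominated_pos (u v : nat -> R) :
  (forall n, 0 <= u n <= v n) -> ex_series v -> ex_series u.
Proof.
  intros Huv. apply (ex_series_le (V := R_CompleteNormedModule)).
  intros n. change (Rabs (u n) <= v n). rewrite Rabs_pos_eq; apply Huv.
Qed.

Lemma term_nonneg (xi : nat -> R) (c : C) (n : nat) : 0 <= Cmod c ^ 2 * xi n ^ 2.
Proof. apply Rmult_le_pos; apply pow2_ge_0. Qed.

(** * Existence of the adjoint as a bounded operator on the space *)

Section Adjoint.

Variables (xi : nat -> R) (nu mu : C).
Hypothesis xi_pos : forall n : nat, 0 < xi n.
Hypothesis xi_root : is_lim_seq (fun n : nat => Rpower (xi n) (/ INR n)) p_infty.
Hypothesis S_bounded : bounded_operator xi (shift_op nu mu).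

Lemma bwd_square_summable (b : nat -> C) :
  square_summable xi b -> square_summable xi (bwd xi nu mu b).
Proof.
  intros Hb. destruct (bwd_norm_bound xi nu mu xi_pos S_bounded) as (M & _ & HM).
  apply (ex_series_dominated_pos _ (fun n => M ^ 2 * (Cmod (b (S n)) ^ 2 * xi (S n) ^ 2))).
  - intros n. split; [apply term_nonneg|apply HM].
  - apply (ex_series_scal_l (V := R_NormedModule) (M ^ 2)
             (fun n => Cmod (b (S n)) ^ 2 * xi (S n) ^ 2)).
    now apply (ex_series_incr_1 (fun n => Cmod (b n) ^ 2 * xi n ^ 2)).
Qed.

Lemma shift_adj_expansion (g : C -> C) :
  in_HE xi g -> has_expansion (bwd xi nu mu (coef g)) (shift_adj xi nu mu g).
Proof.
  intros (_ & _ & Hg). apply shift_adj_spec, abs_entire_expansion.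
  apply (square_summable_abs_entire xi); auto. now apply bwd_square_summable.
Qed.

Lemma shift_adj_in_HE (g : C -> C) : in_HE xi g -> in_HE xi (shift_adj xi nu mu g).
Proof.
  intros Hg. apply (in_HE_intro _ _ _ (shift_adj_expansion g Hg)).
  apply bwd_square_summable, Hg.
Qed.

Lemma shift_adj_coef (g : C -> C) (n : nat) :
  in_HE xi g -> coef (shift_adj xi nu mu g) n = bwd xi nu mu (coef g) n.
Proof. intros Hg. now apply coef_eq, shift_adj_expansion. Qed.

(** Linearity follows because both sides have the same expansion. For the norm, the termwise bound
    compares with [M^2] times the tail of the series of [g], and dropping the nonnegative zeroth
    term only decreases a sum. *)
Lemma shift_adj_bounded : bounded_operator xi (shift_adj xi nu mu).
Proof.
  split; [exact shift_adj_in_HE|]. split.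
  - intros c f g Hf Hg.
    assert (Hcomb : has_expansion
      (fun n => c * bwd xi nu mu (coef f) n + bwd xi nu mu (coef g) n)%C
      (fun z => c * shift_adj xi nu mu f z + shift_adj xi nu mu g z)%C).
    { apply has_expansion_comb; now apply shift_adj_expansion. }
    assert (Hc : forall n, (c * bwd xi nu mu (coef f) n + bwd xi nu mu (coef g) n)%C
                           = bwd xi nu mu (coef (fun w => c * f w + g w)%C) n).
    { intros n. unfold bwd.
      rewrite (coef_eq _ _ (has_expansion_comb c _ _ _ _
                 (in_HE_expansion _ _ Hf) (in_HE_expansion _ _ Hg))). ring. }
    assert (Hcomb' := has_expansion_ext _ _ _ Hc Hcomb).
    refine (has_expansion_unique _ _ _ _ Hcomb').
    apply shift_adj_spec. eexists. exact Hcomb'.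
  - destruct (bwd_norm_bound xi nu mu xi_pos S_bounded) as (M & HM0 & HM).
    exists M. intros g Hg. unfold HE_norm.
    rewrite <- (sqrt_pow2 M) at 1 by easy.
    rewrite <- sqrt_mult_alt by apply pow2_ge_0. apply sqrt_le_1_alt.
    set (s := fun n => Cmod (coef g n) ^ 2 * xi n ^ 2).
    assert (Hs : ex_series s) by apply Hg.
    rewrite (Series_ext _ (fun n => Cmod (bwd xi nu mu (coef g) n) ^ 2 * xi n ^ 2))
      by (intros n; now rewrite shift_adj_coef).
    apply Rle_trans with (Series (fun n => M ^ 2 * s (S n))).
    + apply Series_le.
      * intros n. split; [apply term_nonneg|apply HM].
      * apply (ex_series_scal_l (V := R_NormedModule) (M ^ 2) (fun n => s (S n))).
        now apply (ex_series_incr_1 s).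
    + rewrite Series_scal_l. apply Rmult_le_compat_l; [apply pow2_ge_0|].
      rewrite (Series_incr_1 s Hs).
      assert (H0 := term_nonneg xi (coef g 0%nat) 0). unfold s at 2. lra.
Qed.

(** The zeroth coefficient of [S f] is 0, so after an index shift the two inner products agree term
    by term: the weight [xi n ^ 2] cancels the denominator in [bwd]. *)
Lemma shift_adj_is_adjoint : is_adjoint xi (shift_op nu mu) (shift_adj xi nu mu).
Proof.
  split; [exact shift_adj_bounded|]. intros f g Hf Hg.
  assert (Hff := in_HE_expansion _ _ Hf).
  unfold HE_inner. f_equal.
  all: rewrite Series_incr_1_aux;
    [|rewrite shift_op_coef by easy; simpl; ring].
  all: apply Series_ext; intros n; f_equal.
  all: rewrite shift_op_coef, shift_adj_coef by easy; simpl fwd; unfold bwd.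
  all: assert (Hn : xi n ^ 2 <> 0) by (apply pow_nonzero; specialize (xi_pos n); lra).
  all: replace (xi (S n) ^ 2) with (xi (S n) ^ 2 / xi n ^ 2 * xi n ^ 2) at 1
    by (field; intros F; apply Hn; rewrite F; ring).
  all: rewrite !Cmult_conj, !Cconj_conj, RtoC_mult.
  all: replace (Cconj (RtoC (xi (S n) ^ 2 / xi n ^ 2))) with (RtoC (xi (S n) ^ 2 / xi n ^ 2))
    by (unfold Cconj, RtoC; simpl; now rewrite Ropp_0).
  all: ring.
Qed.

(** * Diagonal form of [T^k S^k] and of the alternating sum *)

(** The exponent of [|mu|] is [2 (n + (n+1) + ... + (n+k-1))], collected along [k] successive shifts
    of [z^n]. The truncated subtraction matters only at [k = n = 0], where the factor [k]
    annihilates it. *)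
Definition weight (k n : nat) : R :=
  Cmod nu ^ (2 * k) * Cmod mu ^ (k * (2 * n + k - 1)) * (xi (n + k)%nat ^ 2 / xi n ^ 2).

Lemma weight_0 (n : nat) : weight 0 n = 1.
Proof.
  unfold weight. rewrite Nat.mul_0_r, Nat.mul_0_l, Nat.add_0_r, !pow_O.
  field. specialize (xi_pos n). lra.
Qed.

(** Reads [T^(k+1) S^(k+1)] as [T (T^k S^k) S]: [S] raises [z^n] to degree [n + 1], the diagonal
    operator acts there, and [T] returns to degree [n]. *)
Lemma weight_S (k n : nat) :
  weight (S k) n
  = Cmod (nu * mu ^ n) ^ 2 * (xi (S n) ^ 2 / xi n ^ 2) * weight k (S n).
Proof.
  unfold weight.
  replace (S k * (2 * n + S k - 1))%nat with (n * 2 + k * (2 * S n + k - 1))%nat by nia.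
  replace (2 * S k)%nat with (2 + 2 * k)%nat by lia.
  replace (n + S k)%nat with (S n + k)%nat by lia.
  rewrite Cmod_mult, Cmod_pow, !pow_add, (pow_mult _ n 2).
  assert (H1 := xi_pos n). assert (H2 := xi_pos (S n)). field. lra.
Qed.

Lemma iter_adjoint_shift_coef (T : (C -> C) -> (C -> C)) (k : nat) (f : C -> C) :
  is_adjoint xi (shift_op nu mu) T -> in_HE xi f ->
  in_HE xi (Nat.iter k T (Nat.iter k (shift_op nu mu) f)) /\
  forall n, coef (Nat.iter k T (Nat.iter k (shift_op nu mu) f)) n
            = (RtoC (weight k n) * coef f n)%C.
Proof.
  intros HT. revert f. induction k as [|k IH]; intros f Hf.
  - split; [exact Hf|]. intros n. rewrite weight_0. simpl. ring.
  - assert (HSf : in_HE xi (shift_op nu mu f)) by now apply S_bounded.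
    destruct (IH _ HSf) as [Hin Hcoef].
    (* Turns [S^k (S f)] into [S (S^k f)], the form in which the iterate at [S k] unfolds. *)
    rewrite Nat.iter_swap in Hin, Hcoef.
    split; [now apply (proj1 HT)|]. intros n.
    change (coef (T (Nat.iter k T (shift_op nu mu (Nat.iter k (shift_op nu mu) f)))) n
            = (RtoC (weight (S k) n) * coef f n)%C).
    rewrite (adjoint_coef xi nu mu T _ n xi_pos HT Hin). unfold bwd.
    rewrite Hcoef, shift_op_coef by now apply in_HE_expansion with xi.
    simpl fwd. rewrite weight_S, !RtoC_mult, Cmod2_conj. ring.
Qed.

Lemma has_expansion_sum (c : nat -> R) (a : nat -> nat -> C) (g : nat -> C -> C) (m : nat) :
  (forall k, has_expansion (a k) (g k)) ->
  has_expansion (fun n => sum_n (fun k => c k * a k n)%C m)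
                (fun z => sum_n (fun k => c k * g k z)%C m).
Proof.
  rewrite has_expansion_iff. intros H z.
  assert (Hk : forall k, is_Cseries (fun n => z ^ n * (c k * a k n))%C (c k * g k z)%C).
  { intros k. apply (is_series_ext (V := C_NormedModule) (fun n => c k * (z ^ n * a k n))%C).
    { intros n. change (?x = ?y) with ((x : C) = y). ring. }
    apply is_Cseries_scal. exact (proj1 (has_expansion_iff _ _) (H k) z). }
  induction m as [|m IH].
  - rewrite sum_O. eapply is_series_ext; [|apply (Hk 0%nat)].
    intros n. simpl. now rewrite sum_O.
  - rewrite sum_Sn. eapply is_series_ext; [|exact (is_Cseries_plus _ _ _ _ IH (Hk (S m)))].
    intros n. simpl. rewrite sum_Sn.
    change (?x = ?y) with ((x : C) = y). change plus with Cplus. ring.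
Qed.

Lemma RtoC_sum_n (u : nat -> R) (c : C) (m : nat) :
  sum_n (fun k => RtoC (u k) * c)%C m = (RtoC (sum_n u m) * c)%C.
Proof.
  induction m as [|m IH]; [now rewrite !sum_O|].
  rewrite !sum_Sn, IH. change (plus (sum_n u m) (u (S m))) with (sum_n u m + u (S m)).
  rewrite RtoC_plus. symmetry. apply Cmult_plus_distr_r.
Qed.

(** The eigenvalue at [z^n] of the operator sum that defines an m-isometry. *)
Definition defect (m n : nat) : R :=
  sum_n (fun k => (-1) ^ (m - k) * Binomial.C m k * weight k n) m.

Lemma defect_expansion (T : (C -> C) -> (C -> C)) (m : nat) (f : C -> C) :
  is_adjoint xi (shift_op nu mu) T -> in_HE xi f ->
  has_expansion (fun n => RtoC (defect m n) * coef f n)%C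
    (fun z => sum_n (fun k => RtoC ((-1) ^ (m - k) * Binomial.C m k)
                * Nat.iter k T (Nat.iter k (shift_op nu mu) f) z)%C m).
Proof.
  intros HT Hf.
  eapply has_expansion_ext; [|apply (has_expansion_sum _
    (fun k n => RtoC (weight k n) * coef f n)%C)].
  - intros n. simpl. unfold defect. rewrite <- RtoC_sum_n. apply sum_n_ext.
    intros k. rewrite !RtoC_mult. apply Cmult_assoc.
  - intros k. destruct (iter_adjoint_shift_coef T k f HT Hf) as [Hin Hcoef].
    exact (has_expansion_ext _ _ _ Hcoef (in_HE_expansion _ _ Hin)).
Qed.

(** Applied to [z^n], the alternating sum has the defect as its n-th coefficient, so its vanishing
    forces the defect to be 0. Conversely [shift_adj] serves as the adjoint, and zero defects make
    every coefficient of the sum vanish. *)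
Lemma m_isometry_iff_defect (m : nat) :
  m_isometry xi m (shift_op nu mu) <-> forall n, defect m n = 0.
Proof.
  split.
  - intros (_ & T & HT & Hsum) n.
    assert (Hn := in_HE_monomial xi n).
    assert (E := expansion_zero_coef _ _ (defect_expansion T m _ HT Hn) (Hsum _ Hn) n).
    simpl in E. rewrite coef_monomial in E. destruct (Nat.eq_dec n n); [|easy].
    rewrite Cmult_1_r in E. now apply RtoC_inj.
  - intros Hd. split; [exact S_bounded|].
    exists (shift_adj xi nu mu). split; [exact shift_adj_is_adjoint|].
    intros f Hf.
    assert (He := defect_expansion _ m f shift_adj_is_adjoint Hf).
    refine (has_expansion_unique _ _ (fun _ => RtoC 0) He _).
    apply has_expansion_iff. intros z.
    apply (is_series_ext (V := C_NormedModule) (fun _ => RtoC 0)).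
    { intros n. rewrite Hd. change (?x = ?y) with ((x : C) = y). ring. }
    exact (is_series_single (V := C_NormedModule) (fun _ => RtoC 0) 0 (fun _ _ => eq_refl)).
Qed.

(** Multiplying by [xi n ^ 2] clears the denominators of the weights. The term [k = 0] is split off
    because it becomes the right-hand side of the criterion. *)
Lemma defect_eq (m n : nat) :
  defect m n * xi n ^ 2
  = (-1) ^ m * xi n ^ 2
    + sum_n_m (fun k : nat =>
        (-1) ^ (m - k) * Binomial.C m k * xi (n + k)%nat ^ 2
        * Cmod nu ^ (2 * k) * Cmod mu ^ (k * (2 * n + k - 1))) 1 m.
Proof.
  assert (Hn := xi_pos n).
  unfold defect, sum_n. rewrite sum_Sn_m by lia. rewrite weight_0, Nat.sub_0_r.
  replace (Binomial.C m 0) with 1.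
  2:{ unfold Binomial.C. rewrite Nat.sub_0_r. simpl. field. apply INR_fact_neq_0. }
  change plus with Rplus.
  rewrite Rmult_plus_distr_r. f_equal; [ring|].
  rewrite <- (sum_n_m_mult_r (K := R_Ring)). apply sum_n_m_ext. intros k.
  change mult with Rmult. change (?x = ?y) with ((x : R) = y).
  unfold weight. field. lra.
Qed.

End Adjoint.

Theorem theorem4p4 (xi : nat -> R)
    (xi_pos : forall n : nat, 0 < xi n)
    (xi_root : is_lim_seq (fun n : nat => Rpower (xi n) (/ INR n)) p_infty)
    (m : nat) (m_pos : (0 < m)%nat)
    (nu mu : C) (mu_le1 : Cmod mu <= 1)
    (S_bounded : bounded_operator xi
       (weighted_composition (fun z : C => (nu * z)%C) (fun z : C => (mu * z)%C))) :
  m_isometry xi m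
    (weighted_composition (fun z : C => (nu * z)%C) (fun z : C => (mu * z)%C))
  <->
  forall n : nat,
    sum_n_m (fun k : nat =>
      (-1) ^ (m - k) * Binomial.C m k * xi (n + k)%nat ^ 2
      * Cmod nu ^ (2 * k) * Cmod mu ^ (k * (2 * n + k - 1))) 1 m
    = (-1) ^ (m + 1) * xi n ^ 2.
Proof.
  rewrite (m_isometry_iff_defect xi nu mu xi_pos xi_root S_bounded m).
  (* As [(-1)^(m+1) = -(-1)^m], the criterion at [n] says that [defect m n * xi n ^ 2] is 0, and
     [xi n ^ 2] is nonzero. *)
  split; intros H n; specialize (H n); assert (E := defect_eq xi nu mu xi_pos m n).
  - rewrite H in E. rewrite pow_add. lra.
  - rewrite H, pow_add in E. apply Rmult_eq_reg_r with (xi n ^ 2).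
    + rewrite E. ring.
    + apply pow_nonzero. specialize (xi_pos n). lra.
Qed.
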